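(* Say that a triple of functions $(p(x),q(x),r(x))$ satisfies Ramanujan's differential equations if $$\frac{dp}{dx}=\frac16(p^2-q),\qquad \frac{dq}{dx}=\frac23(pq-r),\qquad \frac{dr}{dx}=pr-q^2.$$ Suppose $(P(x),Q(x),R(x))$ satisfies Ramanujan's differential equations. Let $T=R+\sqrt{R^2-Q^3}$ and put $$v=\frac32T^{\frac13}+\frac32\frac{Q}{T^{\frac13}},\qquad u=\pm\sqrt3\left(\frac{Q^2}{T^{\frac23}}+Q+T^{\frac23}\right)^{\frac12}$$ (either choice of sign in $u$). Then the triples $$(p_2,q_2,r_2)=\left(P+\frac{u+v}{2},\ \frac89u(u+v)+\frac1{36}(v-u)^2,\ \frac1{54}(3u+v)\left(16u(u+v)-\left(\frac{v-u}{2}\right)^2\right)\right),$$ $$(p_3,q_3,r_3)=\left(P+\frac{v-u}{2},\ \frac89u(u-v)+\frac1{36}(v+u)^2,\ \frac1{54}(v-3u)\left(16u(u-v)-\left(\frac{u+v}{2}\right)^2\right)\right)$$ also satisfy Ramanujan's differential equations, and furthermore so does the triple $$(p_0,q_0,r_0)=\left(P+\frac12T^{\frac13}+\frac12\frac{Q}{T^{\frac13}},\ \frac32Q+\frac54T^{\frac23}+\frac54\frac{Q^2}{T^{\frac23}},\ \frac{11}{4}R+\frac{21}{8}QT^{\frac13}+\frac{21}{8}\frac{Q^2}{T^{\frac13}}\right).$$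
   Context: Conventions: $P,Q,R$ are holomorphic functions of a complex variable $x$ on a connected open set on which $T$ does not vanish and on which holomorphic branches of $\sqrt{R^2-Q^3}$, of $T^{1/3}$, and of the square root defining $u$ are fixed. The same branch of $T^{1/3}$ is used throughout, and $T^{2/3}=(T^{1/3})^2$. *)

(* Defs.v *)
From HB Require Import structures.
From mathcomp Require Import all_boot all_order all_algebra.
From mathcomp Require Import complex.
From mathcomp Require Import all_classical all_reals all_analysis.

Set Implicit Arguments.
Unset Strict Implicit.
Unset Printing Implicit Defensive.

Import Order.TTheory GRing.Theory Num.Theory.
Import numFieldNormedType.Exports.

Local Open Scope classical_set_scope.
Local Open Scope ring_scope.
Local Open Scope complex_scope.

(* [numFieldNormedType] provides the norm topology for abstract number fields
   only; [K[i]] receives it here. *)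
HB.instance Definition _ (K : realType) := NormedModule.copy K[i] K[i]^o.

(* The field of scalars is [K[i]], so the increment in [derivable] and
   [is_derive] (in the direction [1]) is complex: these are the complex
   derivatives. *)
Definition holomorphic_on (K : realType) (D : set K[i]) (f : K[i] -> K[i]) :=
  forall x, D x -> derivable f x 1.

Definition ramanujan_on (K : realType) (D : set K[i])
    (p q r : K[i] -> K[i]) :=
  forall x, D x ->
    [/\ is_derive x 1 p (1 / 6 * (p x ^+ 2 - q x)),
        is_derive x 1 q (2 / 3 * (p x * q x - r x)) &
        is_derive x 1 r (p x * r x - q x ^+ 2)].

(* Main.v *)
Require Import Defs.
From mathcomp Require Import all_boot all_order all_algebra.
From mathcomp Require Import complex.
From mathcomp Require Import all_classical all_reals all_analysis.
From mathcomp Require Import ring.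

Set Implicit Arguments.
Unset Strict Implicit.
Unset Printing Implicit Defensive.

Import Order.TTheory GRing.Theory Num.Theory.
Import numFieldNormedType.Exports.

Local Open Scope classical_set_scope.
Local Open Scope ring_scope.
Local Open Scope complex_scope.

(** Put [a = t] and [b = Q / t].  The defining equation of [T] gives [Q = a b]
    and [2 R = a^3 + b^3].  Differentiating [s^2 = R^2 - Q^3] yields
    [s (s' - P s) = 0], hence [s' = P s], and then
    [a' = (P a - b^2) / 3], [b' = (P b - a^2) / 3].  In the same way
    [u^2 = 3 (a^2 + a b + b^2)] gives [u (u' - u (P / 3 - v / 9)) = 0].  All
    three triples are polynomials in [P], [a], [b] or in [P], [u], [v], so that
    their differential equations become polynomial identities.  The delicate
    point is the division by [s] and by [u] at their zeros. *)

(** * Complex derivatives along the real direction, and the equation [f' = g f] *)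

Section ComplexDerivative.
Variable K : realType.
Implicit Types (f g : K[i] -> K[i]) (x z d : K[i]).

Lemma is_derive1_cvgP f x d :
  is_derive x 1 f d <->
  (h^-1 * (f (h + x) - f x)) @[h --> (0 : K[i])^'] --> d.
Proof.
have -> : (fun h : K[i] => h^-1 * (f (h + x) - f x)) =
    (fun h => h^-1 *: ((f \o shift x) (h *: 1) - f x)).
  by apply/funext => h /=; rewrite [h *: _]mulr1.
split=> [[df <-]|fd]; first exact: df.
by split; [apply/cvg_ex; exists d | apply: cvg_lim].
Qed.

Lemma continuous_Re : continuous (@complex.Re K : K[i] -> K).
Proof.
move=> x.
have FF : Filter (nbhs x) by exact: nbhs_filter.
apply/(@cvgrPdist_lt _ _ _ _ FF) => e e0.
near=> y; rewrite -ltcR -raddfB.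
apply: le_lt_trans (normc_ge_Re _) _.
by near: y; apply: cvgr_dist_lt; [exact: cvg_id|rewrite ltcR].
Unshelve. all: by end_near. Qed.

Lemma normc_real (h : K) : `|h%:C| = `|h|%:C.
Proof. by rewrite normc_def /= expr0n addr0 sqrtr_sqr. Qed.

Lemma cvg_real_complex (h0 : K) : (h%:C @[h --> h0]) --> h0%:C.
Proof.
apply/cvgrPdist_lt => e e0.
(* A positive element of [K[i]] is real, so the bound [e] descends to [K]. *)
have eE : e = (complex.Re e)%:C by rewrite RRe_real// gtr0_real.
have e1 : 0 < complex.Re e by rewrite -ltcR -eE.
near=> h; rewrite -rmorphB normc_real eE ltcR.
by near: h; apply: cvgr_dist_lt; [exact: cvg_id|].
Unshelve. all: by end_near. Qed.

Lemma cvg_dnbhs_real_complex : (h%:C @[h --> (0 : K)^']) --> (0 : K[i])^'.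
Proof.
move=> A /= A0.
have := @cvg_real_complex 0 _ A0; rewrite /= => H.
apply: (@filterS _ (nbhs (0 : K)) _ _ _ _ H) => h /= {}H h0; apply: H.
by rewrite -[0]/(0%:C) (inj_eq (@complexI _)).
Qed.

(** Real increments are special complex increments, and [Re] is continuous and commutes with real
    scaling. This brings the real mean value theorem to bear on [f]. *)
Lemma is_derive_Re f z (a : K) d :
  is_derive (z + a%:C) 1 f d ->
  is_derive a 1 (fun b : K => complex.Re (f (z + b%:C))) (complex.Re d).
Proof.
move=> /is_derive1_cvgP fd.
have cv : (h^-1 *: ((fun b : K => complex.Re (f (z + b%:C))) (h *: 1 + a) -
      complex.Re (f (z + a%:C)))) @[h --> (0:K)^'] --> complex.Re d.
  have := cvg_comp _ _ (cvg_comp _ _ cvg_dnbhs_real_complex fd) (@continuous_Re d).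
  apply: cvg_trans; apply: near_eq_cvg; near=> h => /=.
  rewrite [h *: 1]mulr1 -fmorphV.
  have -> : z + (h + a)%:C = h%:C + (z + a%:C) by rewrite rmorphD addrCA.
  set A := f _; set B := f _.
  by case: A => A1 A2; case: B => B1 B2; rewrite /= mul0r subr0.
by split; [apply/cvg_ex; exists (complex.Re d) | apply: cvg_lim].
Unshelve. all: by end_near. Qed.

Lemma derivable_continuous_at f x : derivable f x 1 -> {for x, continuous f}.
Proof. by move=> fx; apply: differentiable_continuous; apply/derivable1_diffP. Qed.

(* At a zero [x] of [f] the equation [f' = g f] follows by continuity from the
   neighbouring points. As continuity of [f'] is not available, suppose
   [c := f' x != 0]: along the real direction [Re (f / c)] has slope [1] at [x],
   so [f] has no other zero near [x], and there [Re (f' / c) = Re (g f / c)] is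
   small, against the mean value theorem. *)
Lemma derive_eq_mul f g x :
  (\forall y \near x, derivable f y 1) -> {for x, continuous g} ->
  (\forall y \near x, f y * ('D_1 f y - g y * f y) = 0) ->
  'D_1 f x = g x * f x.
Proof.
move=> fD gx fg.
have [fx0|fx0] := eqVneq (f x) 0; last first.
  have /eqP := nbhs_singleton fg.
  by rewrite mulf_eq0 (negbTE fx0) subr_eq0 => /eqP.
rewrite fx0 mulr0; apply/eqP; apply: contraT => c0.
set c := 'D_1 f x in c0.
pose F := c^-1 \*: f.
have FE y : F y = c^-1 * f y by [].
pose phi (b : K) := complex.Re (F (x + b%:C)).
have FD y : derivable f y 1 -> is_derive y 1 F (c^-1 * 'D_1 f y).
  by move=> fy; apply: is_deriveZ; exact: derivableP.
have xcvg : (x + b%:C) @[b --> (0 : K)] --> x.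
  have := cvgD (cvg_cst x) (@cvg_real_complex 0).
  by rewrite /= addr0; apply.
have fx : derivable f x 1 := nbhs_singleton fD.
have phi1 : is_derive (0 : K) (1 : K) phi (1 : K).
  have := @is_derive_Re F x 0 (c^-1 * c).
  rewrite mulVf// addr0; apply; rewrite -[X in is_derive _ _ _ X](mulVf c0).
  exact: FD.
have gf : g y * F y @[y --> x] --> (0 : K[i]).
  have -> : 0 = g x * F x by rewrite FE fx0 !mulr0.
  apply: (@cvgM _ _ (nbhs x) _ g F _ _ gx).
  exact: (derivable_continuous_at (@ex_derive _ _ _ _ _ _ _ (FD _ fx))).
(* The threshold [1/2] separates the slope [1] of [phi] at [0] from the limit [0] of [g F] at
   [x]. *)
have h2 : 0 < (2^-1 : K)%:C by rewrite ltcR invr_gt0.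
have near1 : \forall y \near x, [/\ derivable f y 1,
    f y * ('D_1 f y - g y * f y) = 0 & `|g y * F y| < (2^-1)%:C].
  have gfs : \forall y \near x, `|0 - g y * F y| < (2^-1)%:C.
    exact: (@cvgr_dist_lt _ _ _ (nbhs x) _ _ _ gf).
  move: fD fg gfs; apply: (@filterS3 _ (nbhs x)) => y fy fgy.
  by rewrite sub0r normrN.
have near2 := xcvg _ near1.
have near3 : \forall b \near (0 : K)^', 2^-1 < b^-1 * phi b.
  have phi0 : phi 0 = 0 by rewrite /phi addr0 FE fx0 mulr0.
  have [/= pd pe] := phi1.
  have : (fun h : K => h^-1 *: ((phi \o shift 0) (h *: 1) - phi 0)) @ (0 : K)^' --> (1 : K).
    by rewrite -[X in _ --> X]pe; exact: pd.
  have -> : (fun h : K => h^-1 *: ((phi \o shift 0) (h *: 1) - phi 0)) =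
      (fun h => h^-1 * phi h).
    by apply/funext => h /=; rewrite phi0 subr0 addr0 [h *: 1]mulr1.
  by move/cvgr_gt; apply; rewrite invf_lt1// ltr1n.
have [e /= e0 He] : exists2 e : K, 0 < e & forall b : K, `|b| < e ->
    [/\ derivable f (x + b%:C) 1,
    f (x + b%:C) * ('D_1 f (x + b%:C) - g (x + b%:C) * f (x + b%:C)) = 0,
    `|g (x + b%:C) * F (x + b%:C)| < (2^-1)%:C &
    b != 0 -> 2^-1 < b^-1 * phi b].
  move: near2 near3 => /= [e1 /= e10 H1] [e2 /= e20 H2].
  exists (Num.min e1 e2); first by rewrite lt_min e10.
  move=> b; rewrite lt_min => /andP[b1 b2].
  have [] := H1 b; first by rewrite /= sub0r normrN.
  by split=> // ?; apply: H2 => //=; rewrite sub0r normrN.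
(* Halving the radius keeps the closed segment from [0] to [e / 2] inside the ball, endpoint
   included. *)
have e2 : 0 < e / 2 by rewrite divr_gt0.
have small b : 0 <= b <= e / 2 -> `|b| < e.
  move=> /andP[b0 be]; rewrite ger0_norm//; apply: le_lt_trans be _.
  by rewrite ltr_pdivrMr// ltr_pMr// ltr1n.
pose dphi b := complex.Re (c^-1 * 'D_1 f (x + b%:C)).
have phiD b : 0 <= b <= e / 2 -> is_derive b (1 : K) phi (dphi b).
  by move=> /small /He[fb _ _ _]; apply: is_derive_Re; exact: FD.
have [||b] := @MVT K phi dphi 0 (e / 2) e2.
- by move=> b; rewrite in_itv /= => /andP[/ltW ? /ltW ?]; apply: phiD; apply/andP.
- apply: derivable_within_continuous => b; rewrite in_itv /= => /phiD.
  by case.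
rewrite in_itv /= => /andP[b0 be].
have bs : `|b| < e by apply: small; rewrite (ltW b0) ltW.
have [_ fgb gb /(_ (lt0r_neq0 b0)) phib] := He b bs.
have [|_ _ _ /(_ (lt0r_neq0 e2)) phie] := He (e / 2).
  by apply: small; rewrite lexx ltW.
(* A zero of [f] here would make [phi b / b] zero instead of larger than [1/2]; hence the factor [f]
   cancels in [fgb]. *)
have fb0 : f (x + b%:C) != 0.
  apply: contraTneq phib => fb; rewrite /phi FE fb mulr0 /= mulr0.
  by rewrite -leNgt invr_ge0.
move/eqP: fgb; rewrite mulf_eq0 (negbTE fb0) subr_eq0 /= => /eqP fgb.
have -> : phi 0 = 0 by rewrite /phi addr0 FE fx0 mulr0.
rewrite !subr0 => phiE.
have : dphi b < 2^-1.
  rewrite /dphi fgb mulrCA -FE -ltcR; apply: le_lt_trans gb.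
  apply: le_trans (normc_ge_Re _); rewrite lecR; exact: ler_norm.
by rewrite ltNge ltW//; apply: lt_le_trans phie _; rewrite phiE mulrCA mulVf ?mulr1// lt0r_neq0.
Unshelve. all: by end_near. Qed.

End ComplexDerivative.

(** * Differentiation rules for expressions written pointwise *)

Section PointwiseRules.
Variable K : realType.
Implicit Types (f g : K[i] -> K[i]) (x df dg c : K[i]).

Lemma is_derive_fcst c x : is_derive x 1 (fun=> c : K[i]) (0 : K[i]).
Proof. exact: is_derive_cst. Qed.

Lemma is_derive_fadd f g x df dg : is_derive x 1 f df -> is_derive x 1 g dg ->
  is_derive x 1 (fun y => f y + g y) (df + dg).
Proof. by move=> *; exact: is_deriveD. Qed.

Lemma is_derive_fopp f x df : is_derive x 1 f df ->
  is_derive x 1 (fun y => - f y) (- df).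
Proof. by move=> *; exact: is_deriveN. Qed.

Lemma is_derive_fmul f g x df dg : is_derive x 1 f df -> is_derive x 1 g dg ->
  is_derive x 1 (fun y => f y * g y) (f x * dg + g x * df).
Proof. by move=> *; exact: is_deriveM. Qed.

Lemma is_derive_fexp f n x df : is_derive x 1 f df ->
  is_derive x 1 (fun y => f y ^+ n) (n%:R * f x ^+ n.-1 * df).
Proof.
move=> fx; have -> : (fun y => f y ^+ n) = f ^+ n.
  by apply/funext => y; rewrite exprfctE.
exact: is_deriveX.
Qed.

Lemma is_derive_finv f x df : f x != 0 -> is_derive x 1 f df ->
  is_derive x 1 (fun y => (f y)^-1) (- (f x) ^- 2 * df).
Proof.
move=> f0 [fx <-]; split; first exact: derivableV.
exact: (deriveV f0 fx).
Qed.

End PointwiseRules.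

(* [apply] would let type class resolution choose the generic rules, whose
   results involve [*:] instead of [*]. *)
Ltac derivation := repeat first
  [ eassumption
  | notypeclasses refine (is_derive_fcst _ _)
  | notypeclasses refine (is_derive_fadd _ _)
  | notypeclasses refine (is_derive_fopp _)
  | notypeclasses refine (is_derive_fmul _ _)
  | notypeclasses refine (is_derive_fexp _ _)
  | notypeclasses refine (is_derive_finv _ _) ].

Ltac derive_by_rules :=
  notypeclasses refine (is_derive_eq _ _); [derivation |].

Lemma is_derive_unique (K : realType) (f : K[i] -> K[i]) (x d d' : K[i]) :
  is_derive x 1 f d -> is_derive x 1 f d' -> d = d'.
Proof. by move=> [_ <-] [_ <-]. Qed.

(** Here [4/9 v^2 - 1/3 u^2] stands for [Q]. The hypotheses are invariant under [u -> -u], so both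
    triples built from [u] and [v] come from this one statement. *)
Lemma ramanujan_shift (K : realType) (D : set K[i]) (P u v : K[i] -> K[i]) :
  (forall x, D x -> is_derive x 1 P
    (1 / 6 * (P x ^+ 2 - (4 / 9 * v x ^+ 2 - 1 / 3 * u x ^+ 2)))) ->
  (forall x, D x -> is_derive x 1 u (u x * (P x / 3 - v x / 9))) ->
  (forall x, D x -> is_derive x 1 v
    (P x * v x / 3 - u x ^+ 2 / 3 + 2 / 9 * v x ^+ 2)) ->
  ramanujan_on D
    (fun x => P x + (u x + v x) / 2)
    (fun x => 8 / 9 * u x * (u x + v x) + 1 / 36 * (v x - u x) ^+ 2)
    (fun x => 1 / 54 * (3 * u x + v x) *
       (16 * u x * (u x + v x) - ((v x - u x) / 2) ^+ 2)).
Proof.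
move=> dP du dv x Dx; have dPx := dP x Dx; have dux := du x Dx.
by have dvx := dv x Dx; split; derive_by_rules; cbv beta; field.
Qed.

(** * Differential equations of [s], [t], [b = Q / t] and [w] *)

Section Branches.
Variables (K : realType) (D : set K[i]) (P Q R s T t w : K[i] -> K[i]).
Hypothesis openD : open D.
Hypothesis PQR : ramanujan_on D P Q R.
Hypothesis hs : holomorphic_on D s.
Hypothesis sE : forall x, D x -> s x ^+ 2 = R x ^+ 2 - Q x ^+ 3.
Hypothesis TE : forall x, D x -> T x = R x + s x.
Hypothesis T0 : forall x, D x -> T x != 0.
Hypothesis ht : holomorphic_on D t.
Hypothesis tE : forall x, D x -> t x ^+ 3 = T x.
Hypothesis hw : holomorphic_on D w.
Hypothesis wE : forall x, D x ->
  w x ^+ 2 = Q x ^+ 2 / t x ^+ 2 + Q x + t x ^+ 2.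

Let b y := Q y / t y.

(** Openness of [D] makes an identity on [D] hold near [x], so algebraic relations can be
    differentiated. *)
Lemma is_derive_eq_on (f g : K[i] -> K[i]) x d :
  (forall y, D y -> f y = g y) -> D x -> is_derive x 1 f d -> is_derive x 1 g d.
Proof.
move=> fg Dx; apply: near_eq_is_derive.
by apply: (@filterS _ (nbhs x)) (open_nbhs_nbhs (conj openD Dx)) => y; exact: fg.
Qed.

Lemma derive_eq_mul_on (f g : K[i] -> K[i]) x :
  holomorphic_on D f -> {for x, continuous g} ->
  (forall y, D y -> f y * ('D_1 f y - g y * f y) = 0) ->
  D x -> is_derive x 1 f (g x * f x).
Proof.
move=> hf gx fg Dx.
have DD := open_nbhs_nbhs (conj openD Dx).
notypeclasses refine (is_derive_eq (derivableP (hf x Dx)) _).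
apply: derive_eq_mul => //.
- by apply: (@filterS _ (nbhs x)) DD => y; exact: hf.
- by apply: (@filterS _ (nbhs x)) DD => y; exact: fg.
Qed.

(** The terms in [Q^2 R] cancel in [(R^2 - Q^3)' = 2 P (R^2 - Q^3)], which gives
    [s (s' - P s) = 0]. *)
Lemma is_derive_s x : D x -> is_derive x 1 s (P x * s x).
Proof.
move=> Dx; apply: (derive_eq_mul_on hs) => //.
  by have [[dP _] _ _] := PQR Dx; exact: derivable_continuous_at.
move=> y Dy; have [dP dQ dR] := PQR Dy.
have ds := derivableP (hs Dy).
have d1 : is_derive y 1 (fun z => s z ^+ 2) (2%:R * s y ^+ 2.-1 * 'D_1 s y).
  by derivation.
have d2 : is_derive y 1 (fun z => R z ^+ 2 - Q z ^+ 3)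
    (2 * P y * s y ^+ 2).
  by rewrite sE//; derive_by_rules; cbv beta => /=; field.
have /(is_derive_eq_on _ Dy) := d1 => /(_ _ sE) /(is_derive_unique d2) E.
apply: (@mulfI _ 2); first by rewrite pnatr_eq0.
by rewrite mulr0; move/eqP: E; rewrite eq_sym -subr_eq0 => /eqP <- /=; ring.
Qed.

Lemma t_neq0 x : D x -> t x != 0.
Proof.
by move=> Dx; have := T0 Dx; rewrite -tE// expf_eq0.
Qed.

Lemma Q_eq x : D x -> Q x = t x * b x.
Proof. by move=> Dx; rewrite /b mulrC divfK// t_neq0. Qed.

(** Squaring [T - R = s] gives [T^2 - 2 T R + Q^3 = 0]; divide by [2 T = 2 t^3]. *)
Lemma R_eq x : D x -> R x = (t x ^+ 3 + b x ^+ 3) / 2.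
Proof.
move=> Dx; have t0 := t_neq0 Dx.
have : (t x ^+ 3 - R x) ^+ 2 = R x ^+ 2 - Q x ^+ 3.
  by rewrite -sE// tE// TE// addrC addKr.
rewrite Q_eq// => E; apply: (@mulfI _ (2 * t x ^+ 3)).
  by rewrite mulf_neq0 ?pnatr_eq0 ?expf_neq0.
apply/eqP; rewrite -subr_eq0; apply/eqP.
transitivity (R x ^+ 2 - (t x * b x) ^+ 3 - (t x ^+ 3 - R x) ^+ 2); first by field.
by rewrite E subrr.
Qed.

(** The derivative of [t^3 = R + s] is [P t^3 - Q^2]; divide by [3 t^2], which is nonzero. *)
Lemma is_derive_t x : D x -> is_derive x 1 t ((P x * t x - b x ^+ 2) / 3).
Proof.
move=> Dx; have [dP dQ dR] := PQR Dx; have t0 := t_neq0 Dx.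
have dt := derivableP (ht Dx); have ds := is_derive_s Dx.
have d1 : is_derive x 1 (fun y => t y ^+ 3) (3%:R * t x ^+ 3.-1 * 'D_1 t x).
  by derivation.
have d2 : is_derive x 1 (fun y => R y + s y) (P x * t x ^+ 3 - Q x ^+ 2).
  by rewrite tE// TE//; derive_by_rules; cbv beta => /=; ring.
have E : forall y, D y -> t y ^+ 3 = R y + s y by move=> y Dy; rewrite tE// TE.
have := is_derive_unique d2 (is_derive_eq_on E Dx d1); rewrite Q_eq//= => dE.
apply: is_derive_eq dt _; apply: (@mulfI _ (3 * t x ^+ 2)).
  by rewrite mulf_neq0 ?pnatr_eq0 ?expf_neq0.
by rewrite -dE; field.
Qed.

(** Since [b^3 = 2 R - t^3 = R - s], [b] is the counterpart of [t] for the opposite root [-s],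
    whence the symmetric equation. The quotient rule yields it directly. *)
Lemma is_derive_b x : D x -> is_derive x 1 b ((P x * b x - t x ^+ 2) / 3).
Proof.
move=> Dx; have [_ dQ _] := PQR Dx; have t0 := t_neq0 Dx.
have dt := is_derive_t Dx.
derive_by_rules; cbv beta.
by rewrite R_eq// Q_eq//; field.
Qed.

(** The derivative of [w^2] is [2/3 P w^2 - (t^3 + 2 t^2 b + 2 t b^2 + b^3) / 3], and the bracket
    factors as [(t + b) w^2]. *)
Lemma is_derive_w x : D x ->
  is_derive x 1 w ((P x / 3 - (t x + b x) / 6) * w x).
Proof.
move=> Dx; apply: (derive_eq_mul_on (g := fun y => P y / 3 - (t y + b y) / 6) hw) => //.
  have [dP _ _] := PQR Dx; have dt := is_derive_t Dx; have db := is_derive_b Dx.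
  apply: derivable_continuous_at.
  by eapply ex_derive; derivation.
move=> y Dy; have [dP dQ _] := PQR Dy; have dw := derivableP (hw Dy).
have dt := is_derive_t Dy; have db := is_derive_b Dy.
have E z : D z -> w z ^+ 2 = b z ^+ 2 + t z * b z + t z ^+ 2.
  by move=> Dz; rewrite wE// -Q_eq// /b expr_div_n.
have d1 : is_derive y 1 (fun z => w z ^+ 2) (2%:R * w y ^+ 2.-1 * 'D_1 w y).
  by derivation.
have d2 : is_derive y 1 (fun z => b z ^+ 2 + t z * b z + t z ^+ 2)
    (2 * (P y / 3 - (t y + b y) / 6) * w y ^+ 2).
  by rewrite E//; derive_by_rules; cbv beta => /=; field.
have := is_derive_unique d2 (is_derive_eq_on E Dy d1) => /= dE.
apply: (@mulfI _ 2); first by rewrite pnatr_eq0.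
by rewrite mulr0; move/eqP: dE; rewrite eq_sym -subr_eq0 => /eqP <- /=; ring.
Qed.

End Branches.

(** * Assembly of the three triples *)

Theorem theorem1p1 (K : realType) (D : set K[i])
    (P Q R s T t w u v : K[i] -> K[i]) (sgn : bool) :
  open D -> connected D ->
  holomorphic_on D P -> holomorphic_on D Q -> holomorphic_on D R ->
  ramanujan_on D P Q R ->
  (* [s] is a branch of the square root of [R^2 - Q^3] *)
  holomorphic_on D s ->
  (forall x, D x -> s x ^+ 2 = R x ^+ 2 - Q x ^+ 3) ->
  (forall x, D x -> T x = R x + s x) ->
  (forall x, D x -> T x != 0) ->
  (* [t] is a branch of the cube root of [T] *)
  holomorphic_on D t ->
  (forall x, D x -> t x ^+ 3 = T x) ->
  (* [w] is a branch of the square root occurring in [u] *)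
  holomorphic_on D w ->
  (forall x, D x -> w x ^+ 2 = Q x ^+ 2 / t x ^+ 2 + Q x + t x ^+ 2) ->
  (forall x, D x -> v x = 3 / 2 * t x + 3 / 2 * (Q x / t x)) ->
  (* [sgn] is the choice of sign in [u] *)
  (forall x, D x -> u x = (-1) ^+ sgn * (Num.sqrt (3 : K))%:C * w x) ->
  [/\ ramanujan_on D
        (fun x => P x + (u x + v x) / 2)
        (fun x => 8 / 9 * u x * (u x + v x) + 1 / 36 * (v x - u x) ^+ 2)
        (fun x => 1 / 54 * (3 * u x + v x) *
           (16 * u x * (u x + v x) - ((v x - u x) / 2) ^+ 2)),
      ramanujan_on D
        (fun x => P x + (v x - u x) / 2)
        (fun x => 8 / 9 * u x * (u x - v x) + 1 / 36 * (v x + u x) ^+ 2)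
        (fun x => 1 / 54 * (v x - 3 * u x) *
           (16 * u x * (u x - v x) - ((u x + v x) / 2) ^+ 2)) &
      ramanujan_on D
        (fun x => P x + 1 / 2 * t x + 1 / 2 * (Q x / t x))
        (fun x => 3 / 2 * Q x + 5 / 4 * t x ^+ 2
           + 5 / 4 * (Q x ^+ 2 / t x ^+ 2))
        (fun x => 11 / 4 * R x + 21 / 8 * (Q x * t x)
           + 21 / 8 * (Q x ^+ 2 / t x))].
Proof.
move=> oD _ _ _ _ PQR hs sE TE T0 ht tE hw wE vE uE.
pose b y := Q y / t y; pose k : K[i] := (-1) ^+ sgn * (Num.sqrt (3 : K))%:C.
(* The sign disappears on squaring, so both choices of [u] are treated at once. *)
have k2 : k ^+ 2 = 3.
  rewrite exprMn sqrr_sign mul1r -rmorphXn /= sqr_sqrtr ?ler0n//.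
  by rewrite rmorph_nat.
have t0 := t_neq0 T0 tE.
have QE x : D x -> Q x = t x * b x by exact: (Q_eq _ T0 tE).
have RE x : D x -> R x = (t x ^+ 3 + b x ^+ 3) / 2.
  exact: (R_eq sE TE T0 tE).
have dt x : D x -> is_derive x 1 t ((P x * t x - b x ^+ 2) / 3).
  exact: (is_derive_t oD PQR hs sE TE T0 ht tE).
have db x : D x -> is_derive x 1 b ((P x * b x - t x ^+ 2) / 3).
  exact: (is_derive_b oD PQR hs sE TE T0 ht tE).
have dw x : D x -> is_derive x 1 w ((P x / 3 - (t x + b x) / 6) * w x).
  exact: (is_derive_w oD PQR hs sE TE T0 ht tE hw wE).
(* The term [(t^2 + b^2) / 2] of [v'] is rewritten as [u^2 / 3 - 2/9 v^2]. *)
have dv x : D x -> is_derive x 1 v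
    (P x * v x / 3 - u x ^+ 2 / 3 + 2 / 9 * v x ^+ 2).
  move=> Dx; have dtx := dt x Dx; have dbx := db x Dx.
  have E y : D y -> 3 / 2 * t y + 3 / 2 * b y = v y by move=> /vE ->.
  notypeclasses refine (is_derive_eq_on oD E Dx _).
  have -> : u x ^+ 2 = 3 * (b x ^+ 2 + t x * b x + t x ^+ 2).
    by rewrite uE// -/k exprMn k2 wE// -QE// /b expr_div_n.
  by rewrite -E//; derive_by_rules; cbv beta; field.
have du x : D x -> is_derive x 1 u (u x * (P x / 3 - v x / 9)).
  move=> Dx; have dwx := dw x Dx.
  have E y : D y -> k * w y = u y by move=> /uE ->.
  notypeclasses refine (is_derive_eq_on oD E Dx _).
  by rewrite -E// vE// -/(b x); derive_by_rules; cbv beta; field.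
(* [Q = t b] is the difference of [(t + b)^2 = 4/9 v^2] and [t^2 + t b + b^2 = u^2 / 3]. *)
have dP x : D x -> is_derive x 1 P
    (1 / 6 * (P x ^+ 2 - (4 / 9 * v x ^+ 2 - 1 / 3 * u x ^+ 2))).
  move=> Dx; have [dP _ _] := PQR x Dx.
  notypeclasses refine (is_derive_eq dP _).
  rewrite uE// -/k exprMn k2 wE// -expr_div_n -/(b x) QE// vE// -/(b x).
  by field.
split.
- exact: (ramanujan_shift dP du dv).
(* The second triple is the first with [-u] in place of [u]. *)
- have N x : (- u x) ^+ 2 = u x ^+ 2 by rewrite sqrrN.
  have dPN x : D x -> is_derive x 1 P
      (1 / 6 * (P x ^+ 2 - (4 / 9 * v x ^+ 2 - 1 / 3 * (- u x) ^+ 2))).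
    by rewrite N; exact: dP.
  have dNu x : D x -> is_derive x 1 (fun y => - u y) (- u x * (P x / 3 - v x / 9)).
    by move=> Dx; have dux := du x Dx; derive_by_rules; ring.
  have dvN x : D x -> is_derive x 1 v
      (P x * v x / 3 - (- u x) ^+ 2 / 3 + 2 / 9 * v x ^+ 2).
    by rewrite N; exact: dv.
  have := ramanujan_shift dPN dNu dvN.
  by congr ramanujan_on; apply/funext => y; field.
- move=> x Dx; have [dPx dQ dR] := PQR x Dx; have dtx := dt x Dx; have dbx := db x Dx.
  (* Quotients by [t] are folded into [b], whose derivative is known; after [RE] and [QE] only
     identities in [P], [t], [b] are left. *)
  have -> : (fun y => P y + 1 / 2 * t y + 1 / 2 * (Q y / t y)) =
    (fun y => P y + 1 / 2 * t y + 1 / 2 * b y) by [].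
  have -> : (fun y => 3 / 2 * Q y + 5 / 4 * t y ^+ 2 + 5 / 4 * (Q y ^+ 2 / t y ^+ 2)) =
      (fun y => 3 / 2 * Q y + 5 / 4 * t y ^+ 2 + 5 / 4 * b y ^+ 2).
    by apply/funext => y; rewrite /b expr_div_n.
  have -> : (fun y => 11 / 4 * R y + 21 / 8 * (Q y * t y) + 21 / 8 * (Q y ^+ 2 / t y)) =
      (fun y => 11 / 4 * R y + 21 / 8 * (Q y * t y) + 21 / 8 * (Q y * b y)).
    by apply/funext => y; rewrite /b [Q y * (_ / _)]mulrA -expr2.
  by have tx0 := t0 x Dx; split; derive_by_rules; cbv beta; rewrite ?RE// ?QE//; field.
Qed.
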